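(* Let $0<\alpha<1$ and consider the Robertson-Walker cosmology with scale factor $a(t)=t^{\alpha}$. Let $\tau>0$, let $v=\alpha\chi/\tau^{1-\alpha}$, and suppose $0<v<\frac{\alpha}{1-\alpha}$. Then the spectroscopic and astrometric speeds of the comoving test particle with fixed coordinate $\chi$, relative to the comoving central observer $\beta$ at proper time $\tau$, are given by $$\|v_{\mathrm{spec}}\|=\frac{1-\left(1-\frac{1-\alpha}{\alpha}v\right)^{\frac{2\alpha}{1-\alpha}}}{1+\left(1-\frac{1-\alpha}{\alpha}v\right)^{\frac{2\alpha}{1-\alpha}}},\qquad \|v_{\mathrm{ast}}\|=\frac{\delta}{\tau}-\frac{1-\alpha}{\alpha}\,v\left(1-\frac{1-\alpha}{\alpha}v\right)^{\frac{2\alpha}{1-\alpha}} .$$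
   Context: For radial motion one works in the two-dimensional spacetime with coordinates $(t,\chi)$, $t>0$, and metric $ds^2=-dt^2+a^2(t)\,d\chi^2$. The central observer is $\beta(\tau)=(\tau,0)$, with 4-velocity $u=\partial/\partial t$; at $p=(\tau,0)$ put $\mathcal S_p=\frac{1}{a(\tau)}\frac{\partial}{\partial\chi}\big|_p$ (a unit vector). A comoving test particle is the curve $\beta'(\tau')=(\tau',\chi)$ with $\chi>0$ constant. The event $q_\ell=(t_\ell,\chi)$, with $t_\ell=t_\ell(\tau,\chi)<\tau$, is the event of the test particle lying on the past-directed null geodesic from $p=(\tau,0)$, i.e. $\int_{t_\ell}^{\tau}\frac{d\bar\tau}{a(\bar\tau)}=\chi$. The condition $0<v<\frac{\alpha}{1-\alpha}$ is exactly the condition that such an event with $t_\ell>0$ exists. The affine distance $\delta=\delta(\tau,\chi)$ from $p$ to $q_\ell$ is the norm of the projection of $\exp_p^{-1}(q_\ell)$ onto $u^\perp$; explicitly $\delta=\int_{t_\ell}^{\tau}\frac{a(\bar\tau)}{a(\tau)}\,d\bar\tau$. Astrometric relative velocity of the comoving particle at $p$: $v_{\mathrm{ast}}=\frac{\partial\delta(\tau,\chi)}{\partial\tau}\mathcal S_p$ ($\chi$ fixed). Spectroscopic relative velocity: letting $w$ be the parallel transport of the particle's 4-velocity $\partial/\partial t|_{q_\ell}$ to $p$ along the null geodesic from $q_\ell$ to $p$, $v_{\mathrm{spec}}$ is the unique vector at $p$ orthogonal to $u$ with $w=\gamma(u+v_{\mathrm{spec}})$ for some scalar $\gamma$. *)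

(* Defs.v *)
From Stdlib Require Import Reals ClassicalEpsilon.
From Coquelicot Require Import Coquelicot.
Open Scope R_scope.

(** Definite description. The value is unspecified unless [P] is satisfied by
    exactly one element; [d] only witnesses that the type is inhabited. *)
Definition the {T : Type} (d : T) (P : T -> Prop) : T :=
  epsilon (inhabits d) (unique P).

(** * Two-dimensional Lorentzian geometry in the chart [(t, chi)], [t > 0] *)

Inductive coord : Set := ct | cx.

Definition sumc (f : coord -> R) : R := f ct + f cx.

Definition event : Type := (R * R)%type.

(** Tangent vectors are given by their components in the coordinate basis
    [d/dt, d/dchi]; the base point is passed separately. *)
Definition vec : Type := (R * R)%type.

Definition comp (k : coord) (x : vec) : R :=
  match k with ct => fst x | cx => snd x end.

Definition vadd (x y : vec) : vec := (fst x + fst y, snd x + snd y).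
Definition vscal (r : R) (x : vec) : vec := (r * fst x, r * snd x).

Definition in_spacetime (e : event) : Prop := 0 < fst e.

Definition metric : Type := event -> coord -> coord -> R.

Definition inner (g : metric) (e : event) (x y : vec) : R :=
  sumc (fun i => sumc (fun j => g e i j * comp i x * comp j y)).

Definition vnorm (g : metric) (e : event) (x : vec) : R :=
  sqrt (Rabs (inner g e x x)).

(** Orthogonal projection of [x] onto the complement of a non-null [u]. *)
Definition proj_orth (g : metric) (e : event) (u x : vec) : vec :=
  vadd x (vscal (- (inner g e x u / inner g e u u)) u).

Definition metric_det (g : metric) (e : event) : R :=
  g e ct ct * g e cx cx - g e ct cx * g e cx ct.

(** Entries of the inverse of the 2x2 matrix [g e]. *)
Definition metric_inv (g : metric) (e : event) (i j : coord) : R :=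
  match i, j with
  | ct, ct => g e cx cx / metric_det g e
  | cx, cx => g e ct ct / metric_det g e
  | ct, cx => - g e ct cx / metric_det g e
  | cx, ct => - g e cx ct / metric_det g e
  end.

Definition partial (k : coord) (f : event -> R) (e : event) : R :=
  match k with
  | ct => Derive (fun s => f (s, snd e)) (fst e)
  | cx => Derive (fun s => f (fst e, s)) (snd e)
  end.

(** [christoffel g e k i j] is Gamma^k_{ij} of the Levi-Civita connection. *)
Definition christoffel (g : metric) (e : event) (k i j : coord) : R :=
  / 2 * sumc (fun l => metric_inv g e k l *
    (partial i (fun e' => g e' l j) e + partial j (fun e' => g e' l i) e
     - partial l (fun e' => g e' i j) e)).

(** Curves are total functions of which only the restriction to the parameter
    interval [0, 1] is constrained. *)

Definition velocity (c : R -> event) (s : R) : vec :=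
  (Derive (fun r => fst (c r)) s, Derive (fun r => snd (c r)) s).

Definition spacetime_curve (c : R -> event) : Prop :=
  forall s, 0 <= s <= 1 ->
    in_spacetime (c s) /\
    ex_derive (fun r => fst (c r)) s /\ ex_derive (fun r => snd (c r)) s.

Definition parallel_along (g : metric) (c : R -> event) (W : R -> vec) : Prop :=
  forall s k, 0 <= s <= 1 ->
    is_derive (fun r => comp k (W r)) s
      (- sumc (fun i => sumc (fun j =>
           christoffel g (c s) k i j * comp i (velocity c s) * comp j (W s)))).

Definition geodesic (g : metric) (c : R -> event) : Prop :=
  spacetime_curve c /\ parallel_along g c (velocity c).

Definition null_geodesic (g : metric) (c : R -> event) : Prop :=
  geodesic g c /\
  forall s, 0 <= s <= 1 ->
    velocity c s <> (0, 0) /\ inner g (c s) (velocity c s) (velocity c s) = 0.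

(** The time orientation is the one in which [d/dt] is future-directed. *)
Definition past_directed (c : R -> event) : Prop :=
  forall s, 0 <= s <= 1 -> fst (velocity c s) < 0.

(** [exp_p x = q]. *)
Definition is_exp (g : metric) (p : event) (x : vec) (q : event) : Prop :=
  exists c, geodesic g c /\ c 0 = p /\ velocity c 0 = x /\ c 1 = q.

Definition exp_inv (g : metric) (p q : event) : vec :=
  the (0, 0) (fun x => is_exp g p x q).

(** Parallel transport of [x] from [q] to [p] along the null geodesic from [q]
    to [p]. *)
Definition null_transport (g : metric) (q p : event) (x : vec) : vec :=
  the (0, 0) (fun w => exists c W,
    null_geodesic g c /\ c 0 = q /\ c 1 = p /\
    parallel_along g c W /\ W 0 = x /\ W 1 = w).

(** * Robertson-Walker observers *)

Definition rw_metric (a : R -> R) : metric :=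
  fun e i j =>
    match i, j with
    | ct, ct => -1
    | cx, cx => a (fst e) ^ 2
    | _, _ => 0
    end.

(** 4-velocity [d/dt] of every comoving observer. *)
Definition comoving_velocity : vec := (1, 0).

Definition central (tau : R) : event := (tau, 0).

Definition radial_unit (a : R -> R) (tau : R) : vec := (0, / a tau).

(** The time [t_l]: the comoving particle at [chi] is met at time [t_l < tau] by
    the past-directed null geodesic from the central observer at [tau]. *)
Definition emission_time (a : R -> R) (tau chi : R) : R :=
  the 0 (fun t => 0 < t < tau /\
    exists c, null_geodesic (rw_metric a) c /\ past_directed c /\
              c 0 = central tau /\ c 1 = (t, chi)).

Definition emission_event (a : R -> R) (tau chi : R) : event :=
  (emission_time a tau chi, chi).

Definition affine_distance (a : R -> R) (tau chi : R) : R :=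
  let g := rw_metric a in
  let p := central tau in
  vnorm g p (proj_orth g p comoving_velocity
               (exp_inv g p (emission_event a tau chi))).

Definition v_ast (a : R -> R) (tau chi : R) : vec :=
  vscal (Derive (fun s => affine_distance a s chi) tau) (radial_unit a tau).

Definition v_spec (a : R -> R) (tau chi : R) : vec :=
  let g := rw_metric a in
  let p := central tau in
  let u := comoving_velocity in
  let w := null_transport g (emission_event a tau chi) p comoving_velocity in
  the (0, 0) (fun x =>
    inner g p x u = 0 /\ exists gamma : R, w = vscal gamma (vadd u x)).

(* Main.v *)
Require Import Defs.
From Stdlib Require Import Reals Lra ClassicalEpsilon.
From Coquelicot Require Import Coquelicot.
Open Scope R_scope.

(** A geodesic conserves its norm and the momentum [a^2 chi']; if it is lightlike
    it also conserves [a t']. In the null coordinate [chi + eta t], with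
    [eta' = 1/a], Rolle's theorem shows that every geodesic joining [p] to the
    emission event is lightlike, so its velocity is [(Q/a, -Q/a^2)] with [Q]
    determined by the endpoints. This makes the inverse exponential map and the
    parallel transport explicit for any scale factor; for [a t = t^alpha] the
    light rays themselves are elementary, since [t^(1+alpha)] is affine along
    them. *)

(** * Definite descriptions and constancy on the unit interval *)

Lemma the_eq {T : Type} (d x : T) (P : T -> Prop) :
  P x -> (forall y, P y -> y = x) -> the d P = x.
Proof.
  intros Px HP.
  apply HP.
  apply (epsilon_spec (inhabits d) (unique P)).
  exists x; split; [exact Px | intros y Py; symmetry; auto].
Qed.

Lemma constant_on_unit_interval (f : R -> R) :
  (forall s, 0 <= s <= 1 -> is_derive f s 0) ->
  forall s, 0 <= s <= 1 -> f s = f 0.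
Proof.
  intros Hf s Hs.
  destruct (Req_dec s 0) as [-> | Hs0]; [reflexivity |].
  symmetry; apply (eq_is_derive f 0 s); [| lra].
  intros r Hr; apply Hf; lra.
Qed.

Lemma increment_of_constant_derivative (f : R -> R) (k : R) :
  (forall s, 0 <= s <= 1 -> is_derive f s k) -> f 1 = f 0 + k.
Proof.
  intros Hf.
  enough (f 1 - k * 1 = f 0 - k * 0) by lra.
  apply (constant_on_unit_interval (fun s => f s - k * s)); [| lra].
  intros s Hs.
  replace 0 with (k - k * 1) by ring.
  apply (is_derive_minus f (fun s => k * s)); [now apply Hf |].
  auto_derive; auto.
Qed.

(** * Parallel transport and conservation laws for a general scale factor *)

Definition scale_factor (a : R -> R) : Prop :=
  forall t, 0 < t -> 0 < a t /\ ex_derive a t.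

(** The only nonzero Christoffel symbols are [Gamma^t_{chi chi} = a a'] and [Gamma^chi_{t chi} =
    Gamma^chi_{chi t} = a' / a]. All later work with the connection goes through these two
    equations. *)
Lemma parallel_along_rw (a : R -> R) (c W : R -> R * R) :
  scale_factor a -> spacetime_curve c ->
  parallel_along (rw_metric a) c W <->
  forall s, 0 <= s <= 1 ->
    is_derive (fun r => fst (W r)) s
      (- (a (fst (c s)) * Derive a (fst (c s)) * snd (velocity c s) * snd (W s)))
    /\
    is_derive (fun r => snd (W r)) s
      (- (Derive a (fst (c s)) / a (fst (c s)) *
          (fst (velocity c s) * snd (W s) + snd (velocity c s) * fst (W s)))).
Proof.
  intros Ha Hc.
  assert (Hsum : forall s k, 0 <= s <= 1 ->
    - sumc (fun i => sumc (fun j =>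
        christoffel (rw_metric a) (c s) k i j * Defs.comp i (velocity c s) * Defs.comp j (W s)))
    = match k with
      | ct => - (a (fst (c s)) * Derive a (fst (c s)) * snd (velocity c s) * snd (W s))
      | cx => - (Derive a (fst (c s)) / a (fst (c s)) *
          (fst (velocity c s) * snd (W s) + snd (velocity c s) * fst (W s)))
      end).
  { intros s k Hs.
    destruct (Ha _ (proj1 (Hc s Hs))) as [Hpos Hder].
    assert (Hsq : Derive (fun t => a t * (a t * 1)) (fst (c s))
                  = 2 * a (fst (c s)) * Derive a (fst (c s))).
    { apply is_derive_unique; auto_derive; [tauto | change (fun x => a x) with a; ring]. }
    destruct k; unfold christoffel, sumc, partial, metric_inv, metric_det, rw_metric;
      simpl; rewrite ?Derive_const, ?Hsq; field; lra. }
  split.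
  - intros H s Hs; split.
    + rewrite <- (Hsum s ct Hs); exact (H s ct Hs).
    + rewrite <- (Hsum s cx Hs); exact (H s cx Hs).
  - intros H s k Hs; rewrite (Hsum s k Hs); destruct k; apply (H s Hs).
Qed.

Lemma curve_derivatives (c : R -> event) (s : R) :
  spacetime_curve c -> 0 <= s <= 1 ->
  0 < fst (c s) /\
  is_derive (fun r => fst (c r)) s (fst (velocity c s)) /\
  is_derive (fun r => snd (c r)) s (snd (velocity c s)).
Proof.
  intros Hc Hs; destruct (Hc s Hs) as (H0 & H1 & H2).
  repeat split; [exact H0 | now apply Derive_correct ..].
Qed.

(** Invariance of the metric under translations in [chi]. *)
Lemma geodesic_momentum (a : R -> R) (c : R -> event) :
  scale_factor a -> geodesic (rw_metric a) c ->
  forall s, 0 <= s <= 1 ->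
    a (fst (c s)) ^ 2 * snd (velocity c s) = a (fst (c 0)) ^ 2 * snd (velocity c 0).
Proof.
  intros Ha [Hc Hg].
  rewrite parallel_along_rw in Hg by assumption.
  apply (constant_on_unit_interval (fun s => a (fst (c s)) ^ 2 * snd (velocity c s))).
  intros s Hs.
  destruct (curve_derivatives c s Hc Hs) as (H0 & Ht & _).
  destruct (Ha _ H0) as [Hpos Hda], (Hg s Hs) as [_ H2].
  pose (T := fun r => fst (c r)); pose (X := fun r => snd (velocity c r)).
  change (is_derive (fun r => a (T r) ^ 2 * X r) s 0).
  auto_derive.
  - repeat split; [exact Hda | eexists; exact Ht | eexists; exact H2].
  - change (fun x => a x) with a.
    rewrite (is_derive_unique (fun r : R => T r) _ _ Ht), (is_derive_unique (fun r : R => X r) _ _ H2).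
    unfold T, X.
    field; lra.
Qed.

(** Metric compatibility of the connection. With [W] the velocity of a geodesic, it carries
    lightlikeness from one parameter to all others. *)
Lemma parallel_inner (a : R -> R) (c W : R -> R * R) :
  scale_factor a -> spacetime_curve c -> parallel_along (rw_metric a) c W ->
  forall s, 0 <= s <= 1 ->
    a (fst (c s)) ^ 2 * snd (W s) ^ 2 - fst (W s) ^ 2
    = a (fst (c 0)) ^ 2 * snd (W 0) ^ 2 - fst (W 0) ^ 2.
Proof.
  intros Ha Hc Hg.
  rewrite parallel_along_rw in Hg by assumption.
  apply (constant_on_unit_interval
           (fun s => a (fst (c s)) ^ 2 * snd (W s) ^ 2 - fst (W s) ^ 2)).
  intros s Hs.
  destruct (curve_derivatives c s Hc Hs) as (H0 & Ht & _).
  destruct (Ha _ H0) as [Hpos Hda], (Hg s Hs) as [H1 H2].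
  pose (T := fun r => fst (c r)).
  pose (W1 := fun r => fst (W r)); pose (W2 := fun r => snd (W r)).
  change (is_derive (fun r => a (T r) ^ 2 * W2 r ^ 2 - W1 r ^ 2) s 0).
  auto_derive.
  - repeat split; [exact Hda | eexists; exact Ht | eexists; exact H2 | eexists; exact H1].
  - change (fun x => a x) with a.
    rewrite (is_derive_unique (fun r : R => T r) _ _ Ht), (is_derive_unique (fun r : R => W1 r) _ _ H1), (is_derive_unique (fun r : R => W2 r) _ _ H2).
    unfold T, W1, W2.
    field; lra.
Qed.

(** Conservation law of the conformal Killing field [a d/dt]. *)
Lemma lightlike_geodesic_conserved (a : R -> R) (c : R -> event) :
  scale_factor a -> geodesic (rw_metric a) c ->
  (forall s, 0 <= s <= 1 ->
     a (fst (c s)) ^ 2 * snd (velocity c s) ^ 2 - fst (velocity c s) ^ 2 = 0) ->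
  forall s, 0 <= s <= 1 ->
    a (fst (c s)) * fst (velocity c s) = a (fst (c 0)) * fst (velocity c 0).
Proof.
  intros Ha [Hc Hg] Hnull.
  rewrite parallel_along_rw in Hg by assumption.
  apply (constant_on_unit_interval (fun s => a (fst (c s)) * fst (velocity c s))).
  intros s Hs.
  destruct (curve_derivatives c s Hc Hs) as (H0 & Ht & _).
  destruct (Ha _ H0) as [Hpos Hda], (Hg s Hs) as [H1 _].
  specialize (Hnull s Hs).
  pose (T := fun r => fst (c r)); pose (X := fun r => fst (velocity c r)).
  change (is_derive (fun r => a (T r) * X r) s 0).
  auto_derive.
  - repeat split; [exact Hda | eexists; exact Ht | eexists; exact H1].
  - change (fun x => a x) with a.
    rewrite (is_derive_unique (fun r : R => T r) _ _ Ht), (is_derive_unique (fun r : R => X r) _ _ H1).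
    unfold T, X.
    (* Substituting the geodesic equation for [t''] makes the derivative of [a t'] a multiple of the
       squared norm of the velocity. *)
    transitivity (- Derive a (fst (c s)) *
      (a (fst (c s)) ^ 2 * snd (velocity c s) ^ 2 - fst (velocity c s) ^ 2));
      [ring | rewrite Hnull; ring].
Qed.

(** * Geodesics and null coordinates *)

Lemma is_derive_along (f df : R -> R) (c : R -> event) (s : R) :
  (forall t, 0 < t -> is_derive f t (df t)) ->
  spacetime_curve c -> 0 <= s <= 1 ->
  is_derive (fun r => f (fst (c r))) s (fst (velocity c s) * df (fst (c s))).
Proof.
  intros Hf Hc Hs; destruct (curve_derivatives c s Hc Hs) as (H0 & Ht & _).
  exact (is_derive_comp f (fun r => fst (c r)) s _ _ (Hf _ H0) Ht).
Qed.

(** By Rolle's theorem applied to the null coordinate [chi + eta t], any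
    geodesic joining two points of one null line is lightlike at some parameter,
    hence everywhere. *)
Lemma geodesic_along_null_line (a eta prim : R -> R) (c : R -> event) :
  scale_factor a ->
  (forall t, 0 < t -> is_derive eta t (/ a t)) ->
  (forall t, 0 < t -> is_derive prim t (a t)) ->
  geodesic (rw_metric a) c ->
  snd (c 0) + eta (fst (c 0)) = snd (c 1) + eta (fst (c 1)) ->
  let Q := prim (fst (c 1)) - prim (fst (c 0)) in
  forall s, 0 <= s <= 1 ->
    velocity c s = (Q / a (fst (c s)), - (Q / a (fst (c s)) ^ 2)).
Proof.
  intros Ha Heta Hprim Hgeo Hends Q.
  pose proof Hgeo as [Hc Hpar].
  assert (Hpos : forall s, 0 <= s <= 1 -> 0 < a (fst (c s))).
  { intros s Hs; apply Ha, Hc, Hs. }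
  set (U := fun s => snd (c s) + eta (fst (c s))).
  assert (HU : forall s, 0 <= s <= 1 ->
    is_derive U s (snd (velocity c s) + fst (velocity c s) * / a (fst (c s)))).
  { intros s Hs.
    apply (is_derive_plus (fun r => snd (c r)) (fun r => eta (fst (c r)))).
    - now apply curve_derivatives.
    - now apply (is_derive_along eta (fun t => / a t)). }
  destruct (MVT_gen U 0 1
    (fun s => snd (velocity c s) + fst (velocity c s) * / a (fst (c s))))
    as (s0 & Hs0 & HMVT).
  { intros s Hs; rewrite Rmin_left, Rmax_right in Hs by lra; apply HU; lra. }
  { intros s Hs; rewrite Rmin_left, Rmax_right in Hs by lra.
    apply continuity_pt_filterlim, (ex_derive_continuous U).
    eexists; apply HU; lra. }
  rewrite Rmin_left, Rmax_right in Hs0 by lra.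
  pose proof (Hpos s0 Hs0) as Hp0.
  assert (HX : snd (velocity c s0) = - (fst (velocity c s0) / a (fst (c s0)))).
  { unfold U in HMVT; unfold Rdiv; lra. }
  assert (Hnull : forall s, 0 <= s <= 1 ->
    a (fst (c s)) ^ 2 * snd (velocity c s) ^ 2 - fst (velocity c s) ^ 2 = 0).
  { intros s Hs.
    rewrite (parallel_inner a c (velocity c)) by assumption.
    rewrite <- (parallel_inner a c (velocity c) Ha Hc Hpar s0 Hs0).
    rewrite HX; field; lra. }
  pose proof (lightlike_geodesic_conserved a c Ha Hgeo Hnull) as HT.
  pose proof (geodesic_momentum a c Ha Hgeo) as HP.
  (* Both sides are constants of motion, so it is enough to compare them at the Rolle point [s0]. *)
  assert (HPT : a (fst (c 0)) ^ 2 * snd (velocity c 0)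
                = - (a (fst (c 0)) * fst (velocity c 0))).
  { rewrite <- (HP s0 Hs0), <- (HT s0 Hs0), HX; field; lra. }
  (* The derivative of [prim] along the curve is the conserved [a t']; over a parameter interval of
     length 1 its increment is that constant. *)
  assert (HQ : a (fst (c 0)) * fst (velocity c 0) = Q).
  { unfold Q.
    rewrite (increment_of_constant_derivative (fun s => prim (fst (c s)))
               (a (fst (c 0)) * fst (velocity c 0))); [ring |].
    intros s Hs; rewrite <- (HT s Hs), Rmult_comm.
    now apply (is_derive_along prim a). }
  intros s Hs.
  pose proof (Hpos s Hs) as Hp.
  rewrite (surjective_pairing (velocity c s)); f_equal.
  - rewrite <- HQ, <- (HT s Hs); field; lra.
  - rewrite <- HQ.
    transitivity (a (fst (c s)) ^ 2 * snd (velocity c s) / a (fst (c s)) ^ 2);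
      [field; lra |].
    rewrite (HP s Hs), HPT; field; lra.
Qed.

Lemma inner_rw (a : R -> R) (e : event) (x y : vec) :
  inner (rw_metric a) e x y = a (fst e) ^ 2 * (snd x * snd y) - fst x * fst y.
Proof. unfold inner, sumc, rw_metric; simpl; ring. Qed.

(** The constants of motion satisfy [P^2 = T^2], so a single sign [sigma] relates them on the whole
    parameter interval, and [chi - sigma eta] is constant. Both signs remain, since no direction of
    travel is prescribed. *)
Lemma null_geodesic_null_coordinates (a eta : R -> R) (c : R -> event) :
  scale_factor a ->
  (forall t, 0 < t -> is_derive eta t (/ a t)) ->
  null_geodesic (rw_metric a) c ->
  snd (c 1) - snd (c 0) = eta (fst (c 1)) - eta (fst (c 0)) \/
  snd (c 1) - snd (c 0) = - (eta (fst (c 1)) - eta (fst (c 0))).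
Proof.
  intros Ha Heta [Hgeo Hn].
  pose proof Hgeo as [Hc Hpar].
  assert (Hnull : forall s, 0 <= s <= 1 ->
    a (fst (c s)) ^ 2 * snd (velocity c s) ^ 2 - fst (velocity c s) ^ 2 = 0).
  { intros s Hs; destruct (Hn s Hs) as [_ H]; rewrite inner_rw in H.
    rewrite <- H; ring. }
  pose proof (lightlike_geodesic_conserved a c Ha Hgeo Hnull) as HT.
  pose proof (geodesic_momentum a c Ha Hgeo) as HP.
  set (T := a (fst (c 0)) * fst (velocity c 0)) in *.
  set (P := a (fst (c 0)) ^ 2 * snd (velocity c 0)) in *.
  assert (Hsigma : exists sigma, (sigma = 1 \/ sigma = -1) /\ P = sigma * T).
  { destruct (Rmult_integral (P - T) (P + T)) as [E | E].
    - transitivity (a (fst (c 0)) ^ 2 *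
        (a (fst (c 0)) ^ 2 * snd (velocity c 0) ^ 2 - fst (velocity c 0) ^ 2));
        [unfold P, T; ring | rewrite (Hnull 0) by lra; ring].
    - exists 1; split; [now left | lra].
    - exists (-1); split; [now right | lra]. }
  destruct Hsigma as (sigma & Hsigma & HPT).
  enough (snd (c 1) - sigma * eta (fst (c 1)) = snd (c 0) - sigma * eta (fst (c 0)))
    by (destruct Hsigma; subst sigma; [left | right]; lra).
  apply (constant_on_unit_interval (fun s => snd (c s) - sigma * eta (fst (c s))));
    [| lra].
  intros s Hs.
  assert (Hpos : 0 < a (fst (c s))) by (apply Ha, Hc, Hs).
  replace 0 with (snd (velocity c s) - sigma * (fst (velocity c s) * / a (fst (c s)))).
  - apply (is_derive_minus (fun r => snd (c r)) (fun r => sigma * eta (fst (c r)))).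
    + now apply curve_derivatives.
    + apply (is_derive_scal (fun r => eta (fst (c r)))).
      now apply (is_derive_along eta (fun t => / a t)).
  - transitivity ((a (fst (c s)) ^ 2 * snd (velocity c s)
                   - sigma * (a (fst (c s)) * fst (velocity c s))) / a (fst (c s)) ^ 2);
      [field; lra |].
    rewrite (HP s Hs), (HT s Hs), HPT; field; lra.
Qed.

(** * Emission time and inverse exponential map *)

Lemma conformal_time_increasing (a eta : R -> R) (t1 t2 : R) :
  scale_factor a ->
  (forall t, 0 < t -> is_derive eta t (/ a t)) ->
  0 < t1 -> t1 < t2 -> eta t1 < eta t2.
Proof.
  intros Ha Heta H1 H12.
  apply (incr_function eta 0 p_infty (fun t => / a t)); simpl; auto.
  intros t Ht _; apply Rinv_0_lt_compat, Ha, Ht.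
Qed.

(** A competing time [t'] has [eta t' < eta tau], so [0 < chi] excludes one family of light rays and
    the other forces [eta t' = eta t]. Strict monotonicity of [eta] then gives uniqueness. *)
Lemma emission_time_eq (a eta : R -> R) (tau chi t : R) (c : R -> event) :
  scale_factor a ->
  (forall t, 0 < t -> is_derive eta t (/ a t)) ->
  0 < chi -> 0 < t < tau -> eta tau - eta t = chi ->
  null_geodesic (rw_metric a) c -> past_directed c ->
  c 0 = central tau -> c 1 = (t, chi) ->
  emission_time a tau chi = t.
Proof.
  intros Ha Heta Hchi Ht Hcone Hn Hpast H0 H1.
  apply the_eq; [split; [exact Ht | now exists c] |].
  intros t' [Ht' (c' & Hn' & _ & H0' & H1')].
  assert (Hlt : eta t' < eta tau) by (apply (conformal_time_increasing a); tauto).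
  assert (Heq : eta t' = eta t).
  { destruct (null_geodesic_null_coordinates a eta c' Ha Heta Hn') as [E | E];
      rewrite H0', H1' in E; simpl in E; lra. }
  destruct (Rtotal_order t t') as [L | [E | L]]; [| now symmetry |].
  - pose proof (conformal_time_increasing a eta t t' Ha Heta (proj1 Ht) L); lra.
  - pose proof (conformal_time_increasing a eta t' t Ha Heta (proj1 Ht') L); lra.
Qed.

(** The curve [c] gives existence. Uniqueness concerns all geodesics from [p] to [q], of any causal
    type; as the endpoints lie on one null line, they all share the same initial velocity. *)
Lemma exp_inv_null_line (a eta prim : R -> R) (p q : event) (c : R -> event) :
  scale_factor a ->
  (forall t, 0 < t -> is_derive eta t (/ a t)) ->
  (forall t, 0 < t -> is_derive prim t (a t)) ->
  snd p + eta (fst p) = snd q + eta (fst q) ->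
  geodesic (rw_metric a) c -> c 0 = p -> c 1 = q ->
  Defs.exp_inv (rw_metric a) p q =
    ((prim (fst q) - prim (fst p)) / a (fst p),
     - ((prim (fst q) - prim (fst p)) / a (fst p) ^ 2)).
Proof.
  intros Ha Heta Hprim Hpq Hc H0 H1.
  assert (Hv : forall c', geodesic (rw_metric a) c' -> c' 0 = p -> c' 1 = q ->
    velocity c' 0 = ((prim (fst q) - prim (fst p)) / a (fst p),
                     - ((prim (fst q) - prim (fst p)) / a (fst p) ^ 2))).
  { intros c' Hc' H0' H1'.
    rewrite (geodesic_along_null_line a eta prim c') by
      (rewrite ?H0', ?H1'; auto; lra).
    now rewrite H0', H1'. }
  apply the_eq.
  - exists c; auto.
  - intros x (c' & Hc' & H0' & Hx & H1').
    rewrite <- Hx; now apply Hv.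
Qed.

(** * Transport along null lines and construction of null geodesics *)

(** In the null frame the transport equations decouple: one component grows like [a], the other like
    [/ a]. The final vector is thus determined by the initial one without an appeal to uniqueness
    for differential equations. *)
Lemma parallel_along_null_line (a : R -> R) (Q : R) (c W : R -> event) :
  scale_factor a -> spacetime_curve c -> parallel_along (rw_metric a) c W ->
  (forall s, 0 <= s <= 1 ->
    velocity c s = (Q / a (fst (c s)), - (Q / a (fst (c s)) ^ 2))) ->
  forall s, 0 <= s <= 1 ->
    (fst (W s) + a (fst (c s)) * snd (W s)) / a (fst (c s))
    = (fst (W 0) + a (fst (c 0)) * snd (W 0)) / a (fst (c 0)) /\
    (fst (W s) - a (fst (c s)) * snd (W s)) * a (fst (c s))
    = (fst (W 0) - a (fst (c 0)) * snd (W 0)) * a (fst (c 0)).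
Proof.
  intros Ha Hc Hpar Hv.
  rewrite parallel_along_rw in Hpar by assumption.
  pose (T := fun r => fst (c r));
    pose (W1 := fun r => fst (W r)); pose (W2 := fun r => snd (W r)).
  split.
  - apply (constant_on_unit_interval
             (fun r => (W1 r + a (T r) * W2 r) / a (T r))); [| assumption].
    intros r Hr.
    destruct (curve_derivatives c r Hc Hr) as (H0 & Ht & _).
    destruct (Ha _ H0) as [Hpos Hda], (Hpar r Hr) as [H1 H2].
    rewrite (Hv r Hr) in Ht, H1, H2; simpl in Ht, H1, H2.
    auto_derive.
    + repeat split; [eexists; exact H1 | exact Hda | eexists; exact Ht
        | eexists; exact H2 | exact Hda | eexists; exact Ht | unfold T; lra].
    + change (fun x => a x) with a.
      rewrite (is_derive_unique (fun r : R => T r) _ _ Ht),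
        (is_derive_unique (fun r : R => W1 r) _ _ H1),
        (is_derive_unique (fun r : R => W2 r) _ _ H2).
      unfold T, W1, W2; field; lra.
  - apply (constant_on_unit_interval
             (fun r => (W1 r - a (T r) * W2 r) * a (T r))); [| assumption].
    intros r Hr.
    destruct (curve_derivatives c r Hc Hr) as (H0 & Ht & _).
    destruct (Ha _ H0) as [Hpos Hda], (Hpar r Hr) as [H1 H2].
    rewrite (Hv r Hr) in Ht, H1, H2; simpl in Ht, H1, H2.
    auto_derive.
    + repeat split; [eexists; exact H1 | exact Hda | eexists; exact Ht
        | eexists; exact H2 | exact Hda | eexists; exact Ht].
    + change (fun x => a x) with a.
      rewrite (is_derive_unique (fun r : R => T r) _ _ Ht),
        (is_derive_unique (fun r : R => W1 r) _ _ H1),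
        (is_derive_unique (fun r : R => W2 r) _ _ H2).
      unfold T, W1, W2; field; lra.
Qed.

(** Converse of the velocity formula: solving [T' = Q / a(T)] produces an affinely parametrized null
    geodesic. The equation is needed near each parameter because the velocity is differentiated
    again, by a two-sided derivative even at 0 and 1. *)
Lemma null_line_geodesic (a eta T : R -> R) (x0 Q : R) :
  scale_factor a ->
  (forall t, 0 < t -> is_derive eta t (/ a t)) ->
  Q <> 0 ->
  (forall s, 0 <= s <= 1 -> locally s (fun r => 0 < T r /\ is_derive T r (Q / a (T r)))) ->
  let c := fun s => (T s, x0 - eta (T s)) in
  null_geodesic (rw_metric a) c /\
  forall s, 0 <= s <= 1 -> velocity c s = (Q / a (T s), - (Q / a (T s) ^ 2)).
Proof.
  intros Ha Heta HQ HT c.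
  assert (Hchi : forall r, 0 < T r /\ is_derive T r (Q / a (T r)) ->
    is_derive (fun r => x0 - eta (T r)) r (- (Q / a (T r) ^ 2))).
  { intros r [H0 H1]; destruct (Ha _ H0) as [Hpos _].
    replace (- (Q / a (T r) ^ 2)) with (0 - Q / a (T r) * / a (T r)) by (field; lra).
    apply (is_derive_minus (fun _ => x0) (fun r => eta (T r))).
    - exact (is_derive_const x0 r).
    - exact (is_derive_comp eta T r _ _ (Heta _ H0) H1). }
  assert (Hvel : forall r, 0 < T r /\ is_derive T r (Q / a (T r)) ->
    velocity c r = (Q / a (T r), - (Q / a (T r) ^ 2))).
  { intros r Hr; unfold velocity, c; simpl; f_equal; apply is_derive_unique;
      [apply Hr | now apply Hchi]. }
  assert (Hat : forall s, 0 <= s <= 1 -> 0 < T s /\ is_derive T s (Q / a (T s)))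
    by (intros s Hs; exact (locally_singleton _ _ (HT s Hs))).
  assert (Hc : spacetime_curve c).
  { intros s Hs; destruct (Hat s Hs) as [H0 H1].
    split; [exact H0 | split; eexists; [exact H1 | now apply Hchi, Hat]]. }
  split; [| auto].
  split; [split; [exact Hc |] |].
  - apply parallel_along_rw; [assumption .. |].
    intros s Hs.
    destruct (Hat s Hs) as [H0 H1]; destruct (Ha _ H0) as [Hpos Hda].
    rewrite (Hvel s (Hat s Hs)); simpl; split.
    + apply is_derive_ext_loc with (fun r => Q / a (T r)).
      { apply filter_imp with (2 := HT s Hs); intros r Hr; exact (eq_sym (f_equal fst (Hvel r Hr))). }
      auto_derive.
      * repeat split; [exact Hda | eexists; exact H1 | lra].
      * change (fun x => a x) with a.
        rewrite (is_derive_unique (fun r : R => T r) _ _ H1); field; lra.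
    + apply is_derive_ext_loc with (fun r => - (Q / a (T r) ^ 2)).
      { apply filter_imp with (2 := HT s Hs); intros r Hr; exact (eq_sym (f_equal snd (Hvel r Hr))). }
      auto_derive.
      * repeat split; [exact Hda | eexists; exact H1 |].
        pose proof (pow_lt _ 2 Hpos); simpl in *; lra.
      * change (fun x => a x) with a.
        rewrite (is_derive_unique (fun r : R => T r) _ _ H1); field; lra.
  - intros s Hs.
    destruct (Hat s Hs) as [H0 H1]; destruct (Ha _ H0) as [Hpos Hda].
    rewrite (Hvel s (Hat s Hs)), inner_rw; simpl; split.
    + intros E; injection E as E _.
      apply HQ; transitivity (Q / a (T s) * a (T s)); [field; lra | rewrite E; ring].
    + field; lra.
Qed.

(** The null frame components [w0 + a w1] and [w0 - a w1] are scaled by [r] and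
    [/ r], where [r] is the redshift factor [a (fst p) / a (fst q)]. *)
Lemma null_transport_comoving (a eta prim : R -> R) (q p : event) (c : R -> event) :
  scale_factor a ->
  (forall t, 0 < t -> is_derive eta t (/ a t)) ->
  (forall t, 0 < t -> is_derive prim t (a t)) ->
  snd p + eta (fst p) = snd q + eta (fst q) ->
  null_geodesic (rw_metric a) c -> c 0 = q -> c 1 = p ->
  let r := a (fst p) / a (fst q) in
  null_transport (rw_metric a) q p comoving_velocity
  = ((r + / r) / 2, (r - / r) / (2 * a (fst p))).
Proof.
  intros Ha Heta Hprim Hpq Hn Hc0 Hc1 r.
  assert (Hvel : forall c', null_geodesic (rw_metric a) c' -> c' 0 = q -> c' 1 = p ->
    forall s, 0 <= s <= 1 ->
      velocity c' s = ((prim (fst p) - prim (fst q)) / a (fst (c' s)),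
                       - ((prim (fst p) - prim (fst q)) / a (fst (c' s)) ^ 2))).
  { intros c' [Hg' _] H0 H1 s Hs; rewrite <- H0, <- H1.
    apply (geodesic_along_null_line a eta prim); auto; rewrite H0, H1; lra. }
  pose proof Hn as [[Hc Hpar] _].
  assert (Hposq : 0 < a (fst q)) by (rewrite <- Hc0; apply Ha, Hc; lra).
  assert (Hposp : 0 < a (fst p)) by (rewrite <- Hc1; apply Ha, Hc; lra).
  assert (Hr : r <> 0) by (unfold r; apply Rgt_not_eq, Rdiv_lt_0_compat; assumption).
  pose (rho := fun s => a (fst (c s)) / a (fst q)).
  (* The vector whose null components are [rho] and [/ rho]; at [q] both equal 1, which is the
     comoving velocity. *)
  pose (W := fun s => ((rho s + / rho s) / 2, (rho s - / rho s) / (2 * a (fst (c s))))).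
  apply the_eq.
  - exists c, W.
    repeat (split; [assumption |]).
    split; [| split].
    + apply parallel_along_rw; [assumption .. |].
      intros s Hs.
      destruct (curve_derivatives c s Hc Hs) as (H0 & Ht & _).
      destruct (Ha _ H0) as [Hpos Hda].
      rewrite (Hvel c Hn Hc0 Hc1 s Hs) in Ht |- *.
      pose (T := fun r => fst (c r)).
      assert (Hne : a (T s) / a (fst q) <> 0)
        by (apply Rgt_not_eq, Rdiv_lt_0_compat; assumption).
      unfold W, rho; simpl; split.
      * change (is_derive
          (fun s => (a (T s) / a (fst q) + / (a (T s) / a (fst q))) / 2) s
          (- (a (T s) * Derive a (T s) *
              - ((prim (fst p) - prim (fst q)) / (a (T s) * (a (T s) * 1))) *
              ((a (T s) / a (fst q) - / (a (T s) / a (fst q))) / (2 * a (T s)))))).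
        auto_derive.
        -- repeat split; [exact Hda | eexists; exact Ht | exact Hda
             | eexists; exact Ht | exact Hne].
        -- change (fun x => a x) with a.
           rewrite (is_derive_unique (fun r : R => T r) _ _ Ht).
           unfold T; simpl; field; lra.
      * change (is_derive
          (fun s => (a (T s) / a (fst q) - / (a (T s) / a (fst q))) / (2 * a (T s))) s
          (- (Derive a (T s) / a (T s) *
              ((prim (fst p) - prim (fst q)) / a (T s) *
               ((a (T s) / a (fst q) - / (a (T s) / a (fst q))) / (2 * a (T s))) +
               - ((prim (fst p) - prim (fst q)) / (a (T s) * (a (T s) * 1))) *
               ((a (T s) / a (fst q) + / (a (T s) / a (fst q))) / 2))))).
        auto_derive.
        -- repeat split; [exact Hda | eexists; exact Ht | exact Hda
             | eexists; exact Ht | exact Hne | exact Hda | eexists; exact Ht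
             | unfold T; lra].
        -- change (fun x => a x) with a.
           rewrite (is_derive_unique (fun r : R => T r) _ _ Ht).
           unfold T; simpl; field; lra.
    + unfold W, rho; rewrite Hc0; unfold comoving_velocity; f_equal; field; lra.
    + unfold W, rho; rewrite Hc1; reflexivity.
  - intros w (c' & W' & Hn' & H0 & H1 & Hpar' & HW0 & HW1).
    pose proof Hn' as [[Hc' _] _].
    (* Any admissible transport, along any admissible null geodesic, has null components [r] and
       [/ r] at [p]. *)
    destruct (parallel_along_null_line a _ c' W' Ha Hc' Hpar' (Hvel c' Hn' H0 H1) 1)
      as [Ep Em]; [lra |].
    rewrite H0, H1, HW0, HW1 in Ep, Em; simpl in Ep, Em.
    assert (Ep' : fst w + a (fst p) * snd w = r).
    { unfold r; transitivity ((fst w + a (fst p) * snd w) / a (fst p) * a (fst p));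
        [field; lra | rewrite Ep; field; lra]. }
    assert (Em' : fst w - a (fst p) * snd w = / r).
    { unfold r; transitivity ((fst w - a (fst p) * snd w) * a (fst p) / a (fst p));
        [field; lra | rewrite Em; field; lra]. }
    rewrite (surjective_pairing w); rewrite <- Em', <- Ep'; f_equal; field; lra.
Qed.

(** * Power-law scale factors and their light rays *)

Lemma Rpower_pos (x y : R) : 0 < Rpower x y.
Proof. apply exp_pos. Qed.

Lemma is_derive_Rpower (y t : R) :
  0 < t -> is_derive (fun x => Rpower x y) t (y * Rpower t (y - 1)).
Proof. intros Ht; apply is_derive_Reals, derivable_pt_lim_power, Ht. Qed.

Lemma scale_factor_power (alpha : R) : scale_factor (fun t => Rpower t alpha).
Proof.
  intros t Ht; split; [apply Rpower_pos | eexists; now apply is_derive_Rpower].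
Qed.

(** A primitive of [t^beta] when [1 + beta <> 0]: [beta = alpha] supplies [prim], and
    [beta = - alpha] the conformal time [eta]. *)
Definition power_prim (beta t : R) : R := Rpower t (1 + beta) / (1 + beta).

Lemma is_derive_power_prim (beta t : R) :
  1 + beta <> 0 -> 0 < t -> is_derive (power_prim beta) t (Rpower t beta).
Proof.
  intros Hb Ht.
  replace (Rpower t beta) with ((1 + beta) * Rpower t (1 + beta - 1) * / (1 + beta)).
  - now apply (is_derive_scal_l (fun x => Rpower x (1 + beta)) t _ (/ (1 + beta))),
      is_derive_Rpower.
  - replace (1 + beta - 1) with beta by ring; field; assumption.
Qed.

Lemma is_derive_power_conformal (alpha : R) :
  0 < alpha < 1 ->
  forall t, 0 < t -> is_derive (power_prim (- alpha)) t (/ Rpower t alpha).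
Proof.
  intros Hal t Ht; rewrite <- Rpower_Ropp; apply is_derive_power_prim; lra.
Qed.

(** Both time orders are covered: the exponential map needs the ray from observer to emission, the
    transport needs the ray from emission to observer. *)
Lemma power_light_ray (alpha t0 t1 x0 x1 : R) :
  0 < alpha < 1 -> 0 < t0 -> 0 < t1 -> t0 <> t1 ->
  x0 + power_prim (- alpha) t0 = x1 + power_prim (- alpha) t1 ->
  exists c, null_geodesic (rw_metric (fun t => Rpower t alpha)) c /\
    c 0 = (t0, x0) /\ c 1 = (t1, x1) /\ (t1 < t0 -> past_directed c).
Proof.
  intros Hal Ht0 Ht1 Hne Hx.
  pose (a := fun t => Rpower t alpha).
  pose proof (scale_factor_power alpha) as Ha; fold a in Ha.
  pose proof (is_derive_power_conformal alpha Hal) as Heta.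
  (* [T^(1 + alpha)] is the affine interpolation [A + B s] between its endpoint values, so
     [Q = B / (1 + alpha)]. *)
  pose (A := Rpower t0 (1 + alpha)); pose (B := Rpower t1 (1 + alpha) - A).
  assert (HA : 0 < A) by apply Rpower_pos.
  assert (HAB : 0 < A + B) by (unfold B; ring_simplify; apply Rpower_pos).
  pose (T := fun s => Rpower (A + B * s) (/ (1 + alpha))).
  assert (Hroot : forall t, 0 < t -> Rpower (Rpower t (1 + alpha)) (/ (1 + alpha)) = t).
  { intros t Ht; rewrite Rpower_mult, Rinv_r by lra; now apply Rpower_1. }
  assert (HT0 : T 0 = t0).
  { unfold T; replace (A + B * 0) with A by ring; now apply Hroot. }
  assert (HT1 : T 1 = t1).
  { unfold T, B; replace (A + _ * 1) with (Rpower t1 (1 + alpha)) by ring.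
    now apply Hroot. }
  assert (HQ : B / (1 + alpha) <> 0 /\ (t1 < t0 -> B / (1 + alpha) < 0)).
  { assert (Hlt : forall u w, 0 < u -> u < w ->
      Rpower u (1 + alpha) < Rpower w (1 + alpha))
      by (intros u w Hu Huw; apply Rlt_Rpower_l; lra).
    assert (Hneg : t1 < t0 -> B / (1 + alpha) < 0).
    { intros L; apply Rdiv_neg_pos; [| lra].
      specialize (Hlt t1 t0 Ht1 L); unfold B, A; lra. }
    split; [| exact Hneg].
    destruct (Rtotal_order t0 t1) as [L | [E | L]]; [| contradiction |].
    - apply Rgt_not_eq, Rdiv_lt_0_compat; [| lra].
      specialize (Hlt t0 t1 Ht0 L); unfold B, A; lra.
    - apply Rlt_not_eq, Hneg, L. }
  assert (Hloc : forall s, 0 <= s <= 1 ->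
    locally s (fun r => 0 < T r /\ is_derive T r (B / (1 + alpha) / a (T r)))).
  { intros s Hs.
    (* An affine function positive at 0 and 1 is positive between them, and by continuity slightly
       beyond. *)
    assert (Hpos : 0 < A + B * s).
    { destruct (Rle_lt_dec 0 B); nra. }
    assert (Hcont : continuous (fun r => A + B * r) s)
      by (apply (ex_derive_continuous (fun r => A + B * r)); auto_derive; auto).
    apply (filter_imp (fun r => 0 < A + B * r));
      [| exact (Hcont _ (open_gt 0 _ Hpos))].
    intros r Hr; split; [apply Rpower_pos |].
    replace (B / (1 + alpha) / a (T r))
      with (B * (/ (1 + alpha) * Rpower (A + B * r) (/ (1 + alpha) - 1))).
    - apply (is_derive_comp (fun x => Rpower x (/ (1 + alpha))) (fun r => A + B * r)).
      + now apply is_derive_Rpower.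
      + auto_derive; [auto | ring].
    - unfold a, T; rewrite Rpower_mult.
      replace (/ (1 + alpha) - 1) with (- (/ (1 + alpha) * alpha)) by (field; lra).
      rewrite Rpower_Ropp; unfold Rdiv; ring. }
  destruct (null_line_geodesic a (power_prim (- alpha)) T
    (x0 + power_prim (- alpha) t0) (B / (1 + alpha)) Ha Heta (proj1 HQ) Hloc)
    as [Hn Hv].
  eexists; split; [exact Hn |].
  cbv beta; rewrite HT0, HT1.
  split; [f_equal; ring | split; [f_equal; lra |]].
  intros L s Hs; rewrite Hv by assumption; simpl.
  apply Rdiv_neg_pos; [now apply HQ | apply Rpower_pos].
Qed.

(** The fraction of conformal time left at emission: [y = (t_l / tau)^(1 - alpha)]. *)
Definition conformal_ratio (alpha tau chi : R) : R :=
  1 - (1 - alpha) * chi / Rpower tau (1 - alpha).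

(** Conformal time is proportional to [t^(1 - alpha)], hence the exponent that converts its ratio
    into a ratio of times. *)
Definition power_emission (alpha tau chi : R) : R :=
  tau * Rpower (conformal_ratio alpha tau chi) (/ (1 - alpha)).

Lemma Rpower_lt_1 (x y : R) : 0 < x < 1 -> 0 < y -> Rpower x y < 1.
Proof.
  intros Hx Hy; replace 1 with (Rpower 1 y)
    by (unfold Rpower; rewrite ln_1, Rmult_0_r; apply exp_0).
  apply Rlt_Rpower_l; lra.
Qed.

Lemma conformal_ratio_lt_1 (alpha tau chi : R) :
  0 < alpha < 1 -> 0 < chi -> conformal_ratio alpha tau chi < 1.
Proof.
  intros Hal Hchi; unfold conformal_ratio.
  enough (0 < (1 - alpha) * chi / Rpower tau (1 - alpha)) by lra.
  apply Rdiv_lt_0_compat; [nra | apply Rpower_pos].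
Qed.

Lemma power_emission_lt (alpha tau chi : R) :
  0 < alpha < 1 -> 0 < tau -> 0 < chi -> 0 < conformal_ratio alpha tau chi ->
  0 < power_emission alpha tau chi < tau.
Proof.
  intros Hal Htau Hchi Hy; unfold power_emission.
  pose proof (conformal_ratio_lt_1 alpha tau chi Hal Hchi).
  set (y := conformal_ratio alpha tau chi) in *.
  pose proof (Rpower_pos y (/ (1 - alpha))).
  assert (Rpower y (/ (1 - alpha)) < 1)
    by (apply Rpower_lt_1; [lra | apply Rinv_0_lt_compat; lra]).
  split; nra.
Qed.

Lemma Rpower_power_emission (alpha tau chi beta : R) :
  0 < tau ->
  Rpower (power_emission alpha tau chi) beta
  = Rpower tau beta * Rpower (conformal_ratio alpha tau chi) (beta / (1 - alpha)).
Proof.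
  intros Htau; unfold power_emission.
  rewrite <- Rpower_mult_distr by (assumption || apply Rpower_pos).
  rewrite Rpower_mult; do 2 f_equal; unfold Rdiv; ring.
Qed.

Lemma power_emission_null_line (alpha tau chi : R) :
  0 < alpha < 1 -> 0 < tau -> 0 < conformal_ratio alpha tau chi ->
  0 + power_prim (- alpha) tau
  = chi + power_prim (- alpha) (power_emission alpha tau chi).
Proof.
  intros Hal Htau Hy; unfold power_prim.
  rewrite Rpower_power_emission by assumption.
  replace (1 + - alpha) with (1 - alpha) by ring.
  replace ((1 - alpha) / (1 - alpha)) with 1 by (field; lra).
  rewrite Rpower_1 by assumption.
  unfold conformal_ratio; pose proof (Rpower_pos tau (1 - alpha)).
  field; lra.
Qed.

Lemma emission_time_power (alpha tau chi : R) :
  0 < alpha < 1 -> 0 < tau -> 0 < chi -> 0 < conformal_ratio alpha tau chi ->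
  emission_time (fun t => Rpower t alpha) tau chi = power_emission alpha tau chi.
Proof.
  intros Hal Htau Hchi Hy.
  pose proof (power_emission_lt alpha tau chi Hal Htau Hchi Hy) as Ht.
  pose proof (power_emission_null_line alpha tau chi Hal Htau Hy) as Hline.
  destruct (power_light_ray alpha tau (power_emission alpha tau chi) 0 chi)
    as (c & Hn & H0 & H1 & Hpast); try lra.
  apply (emission_time_eq _ (power_prim (- alpha))) with c;
    [apply scale_factor_power | exact (is_derive_power_conformal alpha Hal)
    | lra .. | assumption | apply Hpast; lra | assumption | assumption].
Qed.

(** * Affine distance and its rate of change *)

(** Projection leaves the radial component [- Q / a(tau)^2], of norm [|Q| / a(tau)], with [Q] the
    increment of [power_prim alpha] from observation to emission. This is the integral of
    [a / a(tau)] between the two times. *)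
Lemma affine_distance_power (alpha tau chi : R) :
  0 < alpha < 1 -> 0 < tau -> 0 < chi -> 0 < conformal_ratio alpha tau chi ->
  affine_distance (fun t => Rpower t alpha) tau chi
  = tau * (1 - Rpower (conformal_ratio alpha tau chi) ((1 + alpha) / (1 - alpha)))
    / (1 + alpha).
Proof.
  intros Hal Htau Hchi Hy.
  pose proof (power_emission_lt alpha tau chi Hal Htau Hchi Hy) as Ht.
  pose proof (power_emission_null_line alpha tau chi Hal Htau Hy) as Hline.
  destruct (power_light_ray alpha tau (power_emission alpha tau chi) 0 chi)
    as (c & [Hg _] & H0 & H1 & _); try lra.
  unfold affine_distance, emission_event; cbv zeta.
  rewrite emission_time_power by assumption.
  rewrite (exp_inv_null_line _ (power_prim (- alpha)) (power_prim alpha) _ _ c);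
    try assumption.
  2: apply scale_factor_power.
  2: exact (is_derive_power_conformal alpha Hal).
  2: intros t Ht'; apply is_derive_power_prim; lra.
  assert (Hlt : Rpower (conformal_ratio alpha tau chi) ((1 + alpha) / (1 - alpha)) < 1).
  { apply Rpower_lt_1; [| apply Rdiv_lt_0_compat; lra].
    split; [assumption | now apply conformal_ratio_lt_1]. }
  unfold vnorm; rewrite inner_rw.
  unfold proj_orth, vadd, vscal; rewrite !inner_rw.
  unfold power_prim; simpl.
  rewrite Rpower_power_emission by assumption.
  rewrite (Rpower_plus 1 alpha tau), Rpower_1 by assumption.
  set (z := Rpower (conformal_ratio alpha tau chi) ((1 + alpha) / (1 - alpha))) in *.
  pose proof (Rpower_pos tau alpha) as Hpos.
  set (A := Rpower tau alpha) in *.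
  match goal with |- sqrt (Rabs ?e) = _ =>
    replace e with ((tau * (1 - z) / (1 + alpha))²) by (unfold Rsqr; field; lra)
  end.
  rewrite Rabs_pos_eq by apply Rle_0_sqr.
  apply sqrt_Rsqr, Rlt_le, Rdiv_lt_0_compat; [apply Rmult_lt_0_compat |]; lra.
Qed.

Lemma is_derive_conformal_ratio (alpha tau chi : R) :
  0 < tau ->
  is_derive (fun s => conformal_ratio alpha s chi) tau
    ((1 - alpha) * (1 - conformal_ratio alpha tau chi) / tau).
Proof.
  intros Htau.
  apply is_derive_ext with
    (fun s => 1 - (1 - alpha) * chi * Rpower s (- (1 - alpha))).
  { intros s; unfold conformal_ratio; now rewrite Rpower_Ropp. }
  replace ((1 - alpha) * (1 - conformal_ratio alpha tau chi) / tau)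
    with (0 - (1 - alpha) * chi *
            (- (1 - alpha) * Rpower tau (- (1 - alpha) - 1))).
  - apply (is_derive_minus (fun _ => 1)
      (fun s => (1 - alpha) * chi * Rpower s (- (1 - alpha)))).
    + exact (is_derive_const 1 tau).
    + now apply (is_derive_scal (fun s => Rpower s (- (1 - alpha)))), is_derive_Rpower.
  - replace (- (1 - alpha) - 1) with (- (1 - alpha) + - (1)) by ring.
    rewrite Rpower_plus, !Rpower_Ropp, Rpower_1 by assumption.
    unfold conformal_ratio.
    pose proof (Rpower_pos tau (1 - alpha)); field; lra.
Qed.

Lemma is_derive_affine_distance_power (alpha tau chi : R) :
  0 < alpha < 1 -> 0 < tau -> 0 < chi -> 0 < conformal_ratio alpha tau chi ->
  let y := conformal_ratio alpha tau chi in
  is_derive (fun s => affine_distance (fun t => Rpower t alpha) s chi) tau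
    ((1 - Rpower y ((1 + alpha) / (1 - alpha))) / (1 + alpha)
     - (1 - y) * Rpower y (2 * alpha / (1 - alpha))).
Proof.
  intros Hal Htau Hchi Hy y.
  pose proof (is_derive_conformal_ratio alpha tau chi Htau) as Hdy.
  assert (Hcont : continuous (fun s => conformal_ratio alpha s chi) tau)
    by (apply (ex_derive_continuous (fun s => conformal_ratio alpha s chi));
        eexists; exact Hdy).
  pose (m := (1 + alpha) / (1 - alpha)).
  (* The closed form of the distance holds only where the ratio and the time are positive, an open
     condition on [s]. *)
  apply is_derive_ext_loc with
    (fun s => / (1 + alpha) * (s * (1 - Rpower (conformal_ratio alpha s chi) m))).
  { apply (filter_imp (fun s => 0 < conformal_ratio alpha s chi /\ 0 < s));
      [| apply filter_and;
         [exact (Hcont _ (open_gt 0 _ Hy)) | exact (open_gt 0 tau Htau)]].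
    intros s [H1 H2]; rewrite affine_distance_power by assumption.
    fold m; refine (_ : @eq R _ _); field; lra. }
  assert (Hpow : is_derive (fun s => Rpower (conformal_ratio alpha s chi) m) tau
    ((1 - alpha) * (1 - y) / tau * (m * Rpower y (m - 1)))).
  { apply (is_derive_comp (fun x => Rpower x m)); [| exact Hdy].
    now apply is_derive_Rpower. }
  pose (f := fun s => Rpower (conformal_ratio alpha s chi) m).
  change (is_derive (fun s => / (1 + alpha) * (s * (1 - f s))) tau
    ((1 - f tau) / (1 + alpha) - (1 - y) * Rpower y (2 * alpha / (1 - alpha)))).
  auto_derive.
  - eexists; exact Hpow.
  - rewrite (is_derive_unique (fun s : R => f s) _ _ Hpow).
    (* The factor [(1 - alpha) m = 1 + alpha] from the chain rule cancels the prefactor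
       [/ (1 + alpha)]. *)
    replace (2 * alpha / (1 - alpha)) with (m - 1) by (unfold m; field; lra).
    unfold m at 1; field; lra.
Qed.

(** The astrometric velocity points away from the observer. *)
Lemma astrometric_speed_nonneg (alpha y : R) :
  0 < alpha < 1 -> 0 < y < 1 ->
  0 <= (1 - Rpower y ((1 + alpha) / (1 - alpha))) / (1 + alpha)
       - (1 - y) * Rpower y (2 * alpha / (1 - alpha)).
Proof.
  intros Hal Hy.
  replace ((1 + alpha) / (1 - alpha)) with (1 + 2 * alpha / (1 - alpha))
    by (field; lra).
  rewrite Rpower_plus, Rpower_1 by lra.
  set (k := 2 * alpha / (1 - alpha)).
  assert (Hk : alpha <= k).
  { unfold k; apply Rmult_le_reg_r with (1 - alpha); [lra |].
    unfold Rdiv; rewrite Rmult_assoc, Rinv_l by lra; nra. }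
  assert (Hln : ln y <= y - 1).
  { pose proof (exp_ineq1_le (ln y)) as H; rewrite exp_ln in H; lra. }
  (* From [ln y <= y - 1 < 0] and [alpha <= k] follows [y^k <= exp (- alpha (1 - y))]; the other
     factor is at most [exp (alpha (1 - y))]. Over the denominator [1 + alpha], the speed has
     numerator 1 minus this product. *)
  assert (Hb : Rpower y k * (1 + alpha * (1 - y)) <= 1).
  { apply Rle_trans with (exp (- (alpha * (1 - y))) * exp (alpha * (1 - y))).
    - apply Rmult_le_compat; [apply Rlt_le, Rpower_pos | nra | |].
      + unfold Rpower.
        assert (E : k * ln y <= - (alpha * (1 - y))) by nra.
        destruct E as [E | E];
          [now apply Rlt_le, exp_increasing | rewrite E; apply Rle_refl].
      + apply exp_ineq1_le.
    - rewrite <- exp_plus, Rplus_opp_l, exp_0; apply Rle_refl. }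
  replace ((1 - y * Rpower y k) / (1 + alpha) - (1 - y) * Rpower y k)
    with ((1 - Rpower y k * (1 + alpha * (1 - y))) / (1 + alpha)) by (field; lra).
  apply Rdiv_le_0_compat; lra.
Qed.

(** * Relative velocities and their norms *)

Lemma vnorm_radial (a : R -> R) (tau x : R) :
  0 < a tau -> vnorm (rw_metric a) (central tau) (0, x * / a tau) = Rabs x.
Proof.
  intros Ha; unfold vnorm; rewrite inner_rw; simpl.
  replace (_ - 0 * 0) with (x²) by (unfold Rsqr; field; lra).
  rewrite Rabs_pos_eq by apply Rle_0_sqr; apply sqrt_Rsqr_abs.
Qed.

(** Orthogonality removes the time component of the velocity, so [gamma] must be [w0]. *)
Lemma v_spec_eq (a : R -> R) (tau chi w0 w1 : R) :
  w0 <> 0 ->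
  null_transport (rw_metric a) (emission_event a tau chi) (central tau)
    comoving_velocity = (w0, w1) ->
  v_spec a tau chi = (0, w1 / w0).
Proof.
  intros Hw0 Hw; unfold v_spec; cbv zeta; rewrite Hw.
  unfold vscal, vadd, comoving_velocity.
  apply the_eq.
  - rewrite inner_rw; simpl; split; [ring |].
    exists w0; f_equal; field; assumption.
  - intros [x0 x1] [Horth [gamma Hg]]; rewrite inner_rw in Horth; simpl in *.
    injection Hg as E0 E1.
    assert (x0 = 0) by lra; subst x0.
    assert (gamma = w0) by lra; subst gamma.
    f_equal; rewrite E1; field; assumption.
Qed.

Theorem proposition4p2 (alpha tau chi : R)
  (halpha : 0 < alpha < 1) (htau : 0 < tau) :
  let a := fun t : R => Rpower t alpha in
  let v := alpha * chi / Rpower tau (1 - alpha) in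
  0 < v < alpha / (1 - alpha) ->
  let b := Rpower (1 - (1 - alpha) / alpha * v) (2 * alpha / (1 - alpha)) in
  vnorm (rw_metric a) (central tau) (v_spec a tau chi) = (1 - b) / (1 + b) /\
  vnorm (rw_metric a) (central tau) (v_ast a tau chi)
    = affine_distance a tau chi / tau - (1 - alpha) / alpha * v * b.
Proof.
  intros a v Hv b.
  pose proof (Rpower_pos tau (1 - alpha)) as Hp.
  pose (y := conformal_ratio alpha tau chi).
  assert (Hyv : (1 - alpha) / alpha * v = 1 - y)
    by (unfold y, conformal_ratio, v; field; lra).
  assert (Hchi : 0 < chi).
  { replace chi with (v * (Rpower tau (1 - alpha) / alpha)) by (unfold v; field; lra).
    apply Rmult_lt_0_compat; [lra | apply Rdiv_lt_0_compat; lra]. }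
  (* The upper bound on [v] says exactly that some conformal time is left at emission. *)
  assert (Hy : 0 < y).
  { enough ((1 - alpha) / alpha * v < 1) by lra.
    apply Rlt_le_trans with ((1 - alpha) / alpha * (alpha / (1 - alpha))).
    - apply Rmult_lt_compat_l; [apply Rdiv_lt_0_compat |]; lra.
    - right; field; lra. }
  assert (Hy1 : y < 1) by now apply conformal_ratio_lt_1.
  replace b with (Rpower y (2 * alpha / (1 - alpha)))
    by (unfold b; rewrite Hyv; f_equal; ring).
  rewrite Hyv; clear b.
  assert (Hatau : 0 < a tau) by apply Rpower_pos.
  split.
  - pose proof (power_emission_lt alpha tau chi halpha htau Hchi Hy) as Ht.
    pose proof (power_emission_null_line alpha tau chi halpha htau Hy) as Hline.
    destruct (power_light_ray alpha (power_emission alpha tau chi) tau chi 0)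
      as (c & Hn & H0 & H1 & _); try lra.
    assert (Hw : null_transport (rw_metric a) (emission_event a tau chi) (central tau)
                   comoving_velocity
      = let r := a tau / a (power_emission alpha tau chi) in
        ((r + / r) / 2, (r - / r) / (2 * a tau))).
    { unfold emission_event, a; rewrite emission_time_power by assumption.
      apply (null_transport_comoving a (power_prim (- alpha)) (power_prim alpha)
        (power_emission alpha tau chi, chi) (central tau) c); try assumption.
      - apply scale_factor_power.
      - exact (is_derive_power_conformal alpha halpha).
      - intros t Ht'; apply is_derive_power_prim; lra. }
    assert (Hr : a (power_emission alpha tau chi)
                 = a tau * Rpower y (alpha / (1 - alpha)))
      by now apply Rpower_power_emission.
    pose proof (Rpower_pos y (alpha / (1 - alpha))) as Hz.
    assert (Hz1 : Rpower y (alpha / (1 - alpha)) < 1)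
      by (apply Rpower_lt_1; [lra | apply Rdiv_lt_0_compat; lra]).
    replace (2 * alpha / (1 - alpha)) with (alpha / (1 - alpha) + alpha / (1 - alpha))
      by (field; lra).
    rewrite Rpower_plus.
    cbv zeta in Hw; rewrite Hr in Hw.
    (* [z] is [a(t_l) / a(tau)], the inverse of the redshift factor, and [b = z^2]; the speed is
       [(/ z - z) / (/ z + z)]. *)
    set (z := Rpower y (alpha / (1 - alpha))) in *.
    replace (a tau / (a tau * z)) with (/ z) in Hw by (field; lra).
    rewrite Rinv_inv in Hw.
    pose proof (Rinv_0_lt_compat z Hz).
    assert (Hw0 : (/ z + z) / 2 <> 0) by lra.
    rewrite (v_spec_eq _ _ _ _ _ Hw0 Hw).
    replace ((/ z - z) / (2 * a tau) / ((/ z + z) / 2))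
      with ((1 - z * z) / (1 + z * z) * / a tau) by (field; repeat split; nra).
    rewrite vnorm_radial by assumption.
    apply Rabs_pos_eq, Rdiv_le_0_compat; nra.
  - unfold v_ast.
    rewrite (is_derive_unique (fun s : R => affine_distance a s chi) _ _
      (is_derive_affine_distance_power alpha tau chi halpha htau Hchi Hy)).
    fold y; unfold vscal, radial_unit, fst, snd.
    rewrite Rmult_0_r.
    rewrite (vnorm_radial a) by assumption.
    rewrite Rabs_pos_eq by (apply astrometric_speed_nonneg; lra).
    unfold a; rewrite affine_distance_power by assumption.
    fold y; field; lra.
Qed.
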